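(* Let $\mathfrak{m}\subset\mathfrak{n}$ be nilpotent associative $\mathbb{F}_q$-algebras with $U_\mathfrak{m}$ supernormal in $U_\mathfrak{n}$. (1) Choose $\lambda\in\mathfrak{n}^*$ and let $\mu=\lambda\downarrow\mathfrak{m}\in\mathfrak{m}^*$. Then $$\chi_\mathfrak{n}^\lambda\downarrow U_\mathfrak{m}=\frac{|U_\mathfrak{n}\lambda|\,|U_\mathfrak{m}\mu U_\mathfrak{m}|}{|U_\mathfrak{m}\mu|\,|U_\mathfrak{n}\mu U_\mathfrak{n}|}\sum_\nu\chi_\mathfrak{m}^\nu,$$ where the sum is over a set of representatives $\nu\in\mathfrak{m}^*$ of the distinct two-sided $U_\mathfrak{m}$-orbits in $U_\mathfrak{n}\mu U_\mathfrak{n}$. Hence $\chi_\mathfrak{n}^\lambda\downarrow U_\mathfrak{m}$ decomposes as a sum of $\frac{|U_\mathfrak{n}\mu U_\mathfrak{n}|}{|U_\mathfrak{m}\mu U_\mathfrak{m}|}$ distinct supercharacters of $U_\mathfrak{m}$ with the same degree and multiplicity. (2) Choose $\mu\in\mathfrak{m}^*$. Then $$\mathrm{SInd}_{U_\mathfrak{m}}^{U_\mathfrak{n}}(\chi_\mathfrak{m}^\mu)=\sum_\lambda\frac{|U_\mathfrak{m}\mu|\,|U_\mathfrak{n}\lambda U_\mathfrak{n}|}{|U_\mathfrak{n}\lambda|\,|U_\mathfrak{n}\mu U_\mathfrak{n}|}\chi_\mathfrak{n}^\lambda,$$ where the sum is over a set of representatives $\lambda\in\mathfrak{n}^*$ of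 the distinct two-sided $U_\mathfrak{n}$-orbits in $\mathfrak{n}^*$ which on restriction to $\mathfrak{m}$ are equal to $U_\mathfrak{n}\mu U_\mathfrak{n}$.
   Context: $\mathbb{F}_q$ is a finite field; all algebras are finite-dimensional associative $\mathbb{F}_q$-algebras. For a nilpotent $\mathbb{F}_q$-algebra $\mathfrak{n}$, the algebra group is $U_\mathfrak{n}=\{1+X:X\in\mathfrak{n}\}$ with multiplication $(1+X)(1+Y)=1+X+Y+XY$. It acts on $\mathfrak{n}$ by $(1+X)Y=Y+XY$, $Y(1+X)=Y+YX$, and on the dual space $\mathfrak{n}^*$ by $g\lambda(X)=\lambda(g^{-1}X)$, $\lambda g(X)=\lambda(Xg^{-1})$; the left and right actions commute. $U_\mathfrak{n}\lambda$, $\lambda U_\mathfrak{n}$, $U_\mathfrak{n}\lambda U_\mathfrak{n}$ denote left, right and two-sided orbits. The superclass of $g\in U_\mathfrak{n}$ is $\{1+x(g-1)y:x,y\in U_\mathfrak{n}\}$; a subgroup is supernormal if it is a union of superclasses. Fix a nontrivial homomorphism $\theta:\mathbb{F}_q^+\to\mathbb{C}^\times$. The supercharacters of $U_\mathfrak{n}$ are the functions, for $\lambda\in\mathfrak{n}^*$, $$\chi_\mathfrak{n}^\lambda(g)=\frac{|U_\mathfrak{n}\lambda|}{|U_\mathfrak{n}\lambda U_\mathfrak{n}|}\sum_{\mu\in U_\mathfrak{n}\lambda U_\mathfrak{n}}\theta\circ\mu(g-1).$$ $f\downarrow S'$ denotes the restriction of a function $f$ to a subset $S'$ of its domain. When $U_\mathfrak{m}$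 is supernormal in $U_\mathfrak{n}$, one has $gXh\in\mathfrak{m}$ for all $g,h\in U_\mathfrak{n}$, $X\in\mathfrak{m}$, so $U_\mathfrak{n}$ acts on the left and right on $\mathfrak{m}$ by multiplication and on $\mathfrak{m}^*$ by $g\mu(X)=\mu(g^{-1}X)$, $\mu g(X)=\mu(Xg^{-1})$ for $X\in\mathfrak{m}$; for $\mu\in\mathfrak{m}^*$ the orbit $U_\mathfrak{n}\mu U_\mathfrak{n}$ lies in $\mathfrak{m}^*$ and is a disjoint union of two-sided $U_\mathfrak{m}$-orbits. The restriction to $\mathfrak{m}$ of an orbit $\mathcal{O}\subset\mathfrak{n}^*$ is $\{\lambda'\downarrow\mathfrak{m}:\lambda'\in\mathcal{O}\}$. For a superclass function $\chi:U_\mathfrak{m}\to\mathbb{C}$ (a function constant on superclasses of $U_\mathfrak{m}$), superinduction is $$\mathrm{SInd}_{U_\mathfrak{m}}^{U_\mathfrak{n}}(\chi)(g)=\frac{1}{|U_\mathfrak{m}||U_\mathfrak{n}|}\sum_{x,y\in U_\mathfrak{n}}\overset{\circ}{\chi}(x(g-1)y+1),\quad g\in U_\mathfrak{n},$$ where $\overset{\circ}{\chi}(z)=\chi(z)$ if $z\in U_\mathfrak{m}$ and $0$ otherwise. *)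

(* Defs.v *)
From HB Require Import structures.
From mathcomp Require Import all_boot all_order all_algebra all_field.

Set Implicit Arguments.
Unset Strict Implicit.
Unset Printing Implicit Defensive.

Import GRing.Theory Num.Theory.

Local Open Scope ring_scope.

(* Written multiplicatively so that F^+ -> C^* needs no dedicated group types. *)
Definition nontrivial_additive_character (F : finFieldType)
    (C : numClosedFieldType) (theta : F -> C) : Prop :=
  [/\ forall a, theta a != 0,
      {morph theta : a b / a + b >-> a * b}
    & exists a, theta a != 1].

Section AlgebraGroups.

(* Nilpotent algebras are taken inside a unital algebra A, so that 1 + X is
   literally a sum. There is no loss of generality: an abstract nilpotent
   algebra n is an ideal of its unitization F (+) n, and nothing below depends
   on the choice of A. Since F is finite, finvect_type A is A with its finite
   type structure, which is needed to count. *)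
Variables (F : finFieldType) (A : falgType F).
Implicit Types (n m : {vspace A}).

Definition nilpotent_algebra n : Prop :=
  (n * n <= n)%VS /\ exists k, (n ^+ k = 0)%VS.

Definition algebra_group n : {set finvect_type A} :=
  [set g : finvect_type A | (g - 1 : A) \in n].

Definition superclass n (g : finvect_type A) : {set finvect_type A} :=
  [set 1 + x * (g - 1) * y | x in algebra_group n, y in algebra_group n].

(* H is finite, so containing 1 and being closed under products makes it a
   subgroup. *)
Definition supernormal n (H : {set finvect_type A}) : Prop :=
  [/\ H \subset algebra_group n, 1 \in H,
      {in H &, forall x y, x * y \in H}
    & exists2 S : {set finvect_type A},
        S \subset algebra_group n & H = \bigcup_(g in S) superclass n g].

Definition dual n : finType := finvect_type 'Hom(subvs_of n, F^o).

(* The value at X is meaningful only when X \in n. *)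
Definition deval n (lambda : dual n) (X : A) : F :=
  (lambda : 'Hom(subvs_of n, F^o)) (vsproj n X).

(* In these three definitions the function given to linfun is linear; it is the
   intended one when n is stable under multiplication by g^-1, resp. when m is
   contained in n. *)
Definition lact n (g : A) (lambda : dual n) : dual n :=
  linfun (fun X : subvs_of n => deval lambda (g^-1 * vsval X) : F^o).

Definition ract n (lambda : dual n) (g : A) : dual n :=
  linfun (fun X : subvs_of n => deval lambda (vsval X * g^-1) : F^o).

Definition dual_restr n m (lambda : dual n) : dual m :=
  linfun (fun X : subvs_of m => deval lambda (vsval X) : F^o).

(* The acting group is that of n, and the functional acted on lives on m. *)
Definition left_orbit n m (mu : dual m) : {set dual m} :=
  [set lact g mu | g : finvect_type A in algebra_group n].

Definition two_sided_orbit n m (mu : dual m) : {set dual m} :=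
  [set ract (lact g mu) h | g : finvect_type A in algebra_group n,
                            h : finvect_type A in algebra_group n].

Variables (C : numClosedFieldType) (theta : F -> C).

(* As for 'CF(G), functions on an algebra group are extended by 0, so that
   equality of such functions is equality on the group. *)
Definition supercharacter n (lambda : dual n) : {ffun finvect_type A -> C} :=
  [ffun g => if g \in algebra_group n then
     #|left_orbit n lambda|%:R / #|two_sided_orbit n lambda|%:R *
       \sum_(mu in two_sided_orbit n lambda) theta (deval mu (g - 1))
   else 0].

Definition sind n m (chi : {ffun finvect_type A -> C}) :
    {ffun finvect_type A -> C} :=
  [ffun g => if g \in algebra_group n then
     (#|algebra_group m|%:R * #|algebra_group n|%:R)^-1 *
       \sum_(x in algebra_group n) \sum_(y in algebra_group n)
         (let z := x * (g - 1) * y + 1 in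
          if z \in algebra_group m then chi z else 0)
   else 0].

End AlgebraGroups.

(* Main.v *)
From HB Require Import structures.
From mathcomp Require Import all_boot all_order all_algebra all_fingroup.
From mathcomp Require Import pgroup abelian all_field ring.
Require Import Defs.

Set Implicit Arguments.
Unset Strict Implicit.
Unset Printing Implicit Defensive.

Import GRing.Theory Num.Theory.

Local Open Scope ring_scope.

(** Write U, H for the algebra groups of n, m. Supernormality of H says exactly
    that m is stable under left and right multiplication by U, so U x U acts on
    both n^* and m^*, and restriction n^* -> m^* is equivariant.

    A supercharacter value chi^lambda(1 + X) is |U lambda| times the mean of
    theta (lambda' X) over the two-sided orbit of lambda, and a mean over an
    orbit is the mean over the acting group ([orbit_mean]). An equivariant map
    therefore preserves orbit means, so on H the value chi^lambda(1 + X) is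
    |U lambda| times the mean of theta (nu X) over U mu U. Cutting U mu U into
    two-sided H-orbits gives the formula of (1); U normalizes H, so these
    orbits, and the left H-orbits inside them, all have the same size, which
    gives the common degree. Orthogonality of the characters X |-> theta (nu X)
    of m separates the supercharacters of distinct orbits.

    The multiplicity in (1) is a quotient of powers of the characteristic, so it
    is an integer as soon as it is at least 1 ([leq_orbit_cards]). Expressing all
    orbits by stabilizers in U x U, this bound follows from two applications of
    |K /\ X| |N| <= |K| |N /\ X| for N <= K ([leq_card_setI]), together with the
    equality of the row rank and the column rank of the bilinear form
    (X, Y) |-> lambda (X Y) on m x n and on m x m; the latter is proved by summing
    theta (lambda (X Y)) over all X and Y in both orders ([bilinear_kernels]).

    For (2), superinduction averages chi^mu over x (g - 1) y, so it is zero off H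
    and a multiple of the mean of theta (nu (g - 1)) over U mu U on H. The
    orbits in the sum on the other side fill up the preimage of U mu U in n^*. The
    fibres of restriction are cosets of the annihilator of m; the sum of
    theta (lambda X) over such a coset is zero when X is not in m, and
    |n| / |m| equal terms when it is. *)

(** * Sums over orbits and over transversals *)

Section OrbitSums.

Variables (aT : finGroupType) (D : {group aT}) (rT : finType).
Variables (to : action D rT) (G : {group aT}).
Hypothesis sGD : G \subset D.

(** Each point of the orbit is hit by one coset of the stabilizer, hence equally
    often. *)
Lemma orbit_mean (C : numFieldType) (f : rT -> C) x :
  (\sum_(y in orbit to G x) f y) / #|orbit to G x|%:R =
  (\sum_(a in G) f (to x a)) / #|G|%:R.
Proof.
have -> : \sum_(a in G) f (to x a) =
    #|('C_G[x | to])%g|%:R * \sum_(y in orbit to G x) f y.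
  rewrite (partition_big (to x) [in orbit to G x]) => [|a Ga]; last first.
    exact: mem_orbit.
  rewrite big_distrr /=; apply: eq_bigr => _ /orbitP[a Ga <-].
  rewrite (eq_bigr (fun=> f (to x a))) => [|b /andP[_ /eqP->] //].
  rewrite sumr_const mulr_natl -[in RHS](card_rcoset _ a).
  rewrite -(amove_act to x sGD Ga); congr (_ *+ _).
  by apply: eq_card => b; rewrite !inE.
rewrite -[in RHS](card_orbit_in_stab to x sGD) natrM.
have /lt0r_neq0 : 0 < #|('C_G[x | to])%g|%:R :> C by rewrite ltr0n cardG_gt0.
have /lt0r_neq0 : 0 < #|orbit to G x|%:R :> C.
  by rewrite ltr0n card_gt0; apply/set0Pn; exists x; apply: orbit_refl.
move=> o_neq0 c_neq0; rewrite invfM [_^-1 * _]mulrC.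
by rewrite [RHS]mulrACA mulfV ?mul1r.
Qed.

Lemma card_orbit_act_norm a x :
  a \in D -> a \in 'N(G)%g -> #|orbit to G (to x a)| = #|orbit to G x|.
Proof.
move=> Da nGa; rewrite !card_orbit_in // astab1_act_in //.
by rewrite -{1 2}(normP nGa) -conjIg indexJg.
Qed.

End OrbitSums.

Section Transversals.

Variables (T : finType) (orb : T -> {set T}) (D R : {set T}).
Hypotheses (orb_refl : {in D, forall x, x \in orb x})
           (trR : is_transversal R (orb @: D) D).

Let pblock_orb : {in R, forall r, pblock (orb @: D) r = orb r}.
Proof.
move=> r Rr; have Dr := subsetP (transversal_sub trR) r Rr.
have [/and3P[_ tI _] _ _] := and3P trR.
by apply: def_pblock => //; [apply: imset_f | apply: orb_refl].
Qed.

Lemma transversal_orbit_inj : {in R &, injective orb}.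
Proof.
move=> r r' Rr Rr' eq_orb; apply: (pblock_inj trR) => //.
by rewrite !pblock_orb.
Qed.

Lemma big_transversal_orbit (M : nmodType) (f : T -> M) :
  \sum_(x in D) f x = \sum_(r in R) \sum_(x in orb r) f x.
Proof.
have [partD _ _] := and3P trR; have [/eqP covD tI _] := and3P partD.
rewrite -{1}covD big_trivIset //= -{1}(pblock_transversal trR).
rewrite big_imset; last exact: pblock_inj trR.
by apply: eq_bigr => r /pblock_orb->.
Qed.

End Transversals.

(** * Inequalities between indices in finite groups *)

Lemma mem_setX (T1 T2 : finType) (A1 : {set T1}) (A2 : {set T2}) x y :
  ((x, y) \in setX A1 A2) = (x \in A1) && (y \in A2).
Proof. by rewrite in_setX. Qed.

Lemma norm_setX (gT : finGroupType) (G K : {group gT}) u v :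
  u \in 'N(G)%g -> v \in 'N(K)%g -> (u, v) \in 'N(setX G K)%g.
Proof.
move=> nGu nKv; rewrite inE; apply/subsetP => _ /imsetP[[x y] xy ->].
move: xy; rewrite mem_setX => /andP[Gx Ky].
have : (x ^ u, y ^ v)%g \in setX G K by rewrite mem_setX !memJ_norm ?Gx.
by [].
Qed.

(** The product set (K :&: X) * N lies in K and (K :&: X) :&: N = N :&: X. *)
Lemma leq_card_setI (gT : finGroupType) (K N X : {group gT}) :
  N \subset K -> (#|K :&: X| * #|N| <= #|K| * #|N :&: X|)%N.
Proof.
move=> sNK; rewrite mul_cardG -setIA [X :&: N]setIC setIA (setIidPr sNK).
by rewrite leq_mul2r subset_leq_card ?orbT // mul_subG ?subsetIl.
Qed.

Section IndexInequalities.

Variable gT : finGroupType.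
Local Open Scope group_scope.
Local Open Scope nat_scope.

(** When K is the stabilizer of a functional for the two-sided action, these are
    its stabilizers for the left and for the right action. *)
Definition lslice (K : {group gT * gT}) := (@pairg1 gT gT) @*^-1 K.
Definition rslice (K : {group gT * gT}) := (@pair1g gT gT) @*^-1 K.
Canonical lslice_group K := [group of lslice K].
Canonical rslice_group K := [group of rslice K].

Lemma mem_lslice (K : {group gT * gT}) u : (u \in lslice K) = ((u, 1%g) \in K).
Proof. by rewrite !inE. Qed.

Lemma mem_rslice (K : {group gT * gT}) u : (u \in rslice K) = ((1%g, u) \in K).
Proof. by rewrite !inE. Qed.

Lemma setI_setX1l (K : {group gT * gT}) (H : {group gT}) :
  setX H 1%g :&: K = setX (H :&: lslice K) 1%g.
Proof.
apply/setP => -[u v]; rewrite !inE /=.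
by have [->|] := eqVneq v 1%g; rewrite ?andbT ?andbF.
Qed.

(** This is [leq_card_setI] for the subgroup [lslice K] x [rslice K] of K. For a
    stabilizer K it says that the size of the intersection of the left and the
    right orbit can only decrease when the acting group shrinks to H. *)
Lemma leq_card_slices (K : {group gT * gT}) (H : {group gT}) :
  #|K :&: setX H H| * (#|lslice K| * #|rslice K|) <=
  #|K| * (#|lslice K :&: H| * #|rslice K :&: H|).
Proof.
have sNK : setX (lslice K) (rslice K) \subset K.
  apply/subsetP => -[u v]; rewrite in_setX mem_lslice mem_rslice.
  case/andP => Ku Kv; have := groupM Ku Kv; congr (_ \in K).
  by congr pair; rewrite /= (mulg1, mul1g).
have := leq_card_setI (setX_group H H) sNK; rewrite cardsX.
suff -> : setX (lslice K) (rslice K) :&: setX_group H H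
        = setX (lslice K :&: H) (rslice K :&: H) by rewrite cardsX.
by apply/setP => -[u v]; rewrite !inE /= andbACA.
Qed.

End IndexInequalities.

(** * Additive characters and bilinear forms *)

(** The usual vanishing argument for character sums: the sum equals c times
    itself. *)
Lemma sum_eigen_shift (C : numFieldType) (T : finType) (S : {set T})
    (h : T -> T) (c : C) (f : T -> C) :
  injective h -> {in S, forall x, h x \in S} -> c != 1 ->
  {in S, forall x, f (h x) = c * f x} -> \sum_(x in S) f x = 0.
Proof.
move=> inj_h hS c_neq1 fh.
have hSS : h @: S = S.
  apply/eqP; rewrite eqEcard card_imset // leqnn andbT.
  by apply/subsetP => _ /imsetP[x Sx ->]; apply: hS.
have : \sum_(x in S) f x = c * \sum_(x in S) f x.
  rewrite -{1}hSS big_imset /=; last by move=> x y _ _; apply: inj_h.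
  by rewrite big_distrr; apply: eq_bigr => x Sx; rewrite fh.
move/eqP; rewrite -subr_eq0 -{1}[\sum_(x in S) f x]mul1r -mulrBl mulf_eq0.
by rewrite subr_eq0 eq_sym (negPf c_neq1) => /eqP.
Qed.

Section AdditiveCharacters.

Variables (F : finFieldType) (C : numClosedFieldType) (theta : F -> C).
Hypothesis theta_char : nontrivial_additive_character theta.

Lemma theta_add a b : theta (a + b) = theta a * theta b.
Proof. by case: theta_char. Qed.

Lemma theta_0 : theta 0 = 1.
Proof.
have [theta_neq0 _ _] := theta_char.
by apply: (mulfI (theta_neq0 0)); rewrite -theta_add addr0 mulr1.
Qed.

Lemma theta_exists_scale b : b != 0 -> exists a, theta (a * b) != 1.
Proof.
have [_ _ [a theta_a]] := theta_char.
by move=> b_neq0; exists (a / b); rewrite divfK.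
Qed.

Variable A : falgType F.
Local Notation fA := (finvect_type A).

Definition vset (V : {vspace A}) : {set fA} := [set X : fA | (X : A) \in V].

Lemma sum_theta (V : {vspace A}) (f : A -> F) :
  {morph f : X Y / X + Y} -> (forall a, {morph f : X / a *: X >-> a * X}) ->
  \sum_(X in vset V) theta (f X) =
  if [forall X in vset V, f X == 0] then #|vset V|%:R else 0.
Proof.
move=> fD fZ; case: ifPn => [/forall_inP f0 | ].
  rewrite (eq_bigr (fun=> 1)) => [|X VX]; first by rewrite sumr_const.
  by rewrite (eqP (f0 X VX)) theta_0.
rewrite negb_forall_in => /exists_inP[Y]; rewrite inE => VY /theta_exists_scale.
case=> a theta_a.
pose shift (X : fA) : fA := X + a *: (Y : fA).
apply: (@sum_eigen_shift _ _ _ shift _ _ _ _ theta_a).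
- exact: addIr.
- by move=> X; rewrite !inE => VX; rewrite memvD ?memvZ.
by move=> X _; rewrite fD fZ theta_add mulrC.
Qed.

(** Row rank equals column rank, multiplicatively: |V| / |left kernel| and
    |W| / |right kernel| agree because both sides of the identity count
    the double sum of theta (B X Y). *)
Lemma bilinear_kernels (B : A -> A -> F) (V W : {vspace A}) :
    (forall X, {morph B X : Y Z / Y + Z}) ->
    (forall X a, {morph B X : Y / a *: Y >-> a * Y}) ->
    (forall Y, {morph B^~ Y : X Z / X + Z}) ->
    (forall Y a, {morph B^~ Y : X / a *: X >-> a * X}) ->
  (#|vset V| * #|[set Y in vset W | [forall X in vset V, B X Y == 0%R]]| =
   #|vset W| * #|[set X in vset V | [forall Y in vset W, B X Y == 0%R]]|)%N.
Proof.
move=> BDr BZr BDl BZl; apply: (@mulrIn C 1 (oner_neq0 C)).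
pose S : C := \sum_(X in vset V) \sum_(Y in vset W) theta (B X Y).
have half (V' W' : {set fA}) (P : pred fA) :
    \sum_(X in V') (if P X then #|W'|%:R else 0) =
    (#|W'| * #|[set X in V' | P X]|)%:R :> C.
  rewrite -big_mkcondr sumr_const natrM mulr_natr.
  by congr (_ *+ _); apply: eq_card => X; rewrite !inE.
transitivity S; rewrite /S.
  rewrite exchange_big -half; apply: eq_bigr => Y _.
  by rewrite (sum_theta _ (BDl Y) (BZl Y)).
rewrite -half; apply: eq_bigr => X _.
by rewrite (sum_theta _ (BDr X) (BZr X)).
Qed.

End AdditiveCharacters.

(** * Algebra groups as finite groups *)

Section Unipotent.

Variables (F : finFieldType) (A : falgType F).
Local Notation fA := (finvect_type A).
Implicit Types (n m V : {vspace A}).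

Lemma card_algebra_group n : #|algebra_group n| = #|vset n|.
Proof.
rewrite -(card_imset (vset n) (addrI (1 : fA))); apply: eq_card => g.
rewrite inE; apply/idP/imsetP => [ng | [X]].
  by exists (g - 1); rewrite ?inE // addrC subrK.
by rewrite inE => nX ->; rewrite addrC addKr.
Qed.

Section Group.

Variable n : {vspace A}.
Hypothesis nil_n : nilpotent_algebra n.

Lemma nilpotent_algebra_mul X Y : X \in n -> Y \in n -> X * Y \in n.
Proof. by have [/prodvP nn _] := nil_n; apply: nn. Qed.

Lemma algebra_group_mul g h :
  g \in algebra_group n -> h \in algebra_group n -> g * h \in algebra_group n.
Proof.
rewrite !inE => ng nh.
have -> : g * h - 1 = (g - 1) * (h - 1) + (g - 1) + (h - 1).
  by rewrite mulrBl mul1r addrAC subrK mulrBr mulr1 addrA subrK.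
by rewrite memvD ?nh // memvD ?ng // nilpotent_algebra_mul.
Qed.

(** If u = 1 - X with X nilpotent and u Y = 0, then Y = X Y = X^k Y = 0. So left
    multiplication by u is injective on the finite set 1 + n, hence surjective,
    and u has a right inverse in 1 + n; that inverse has one too, so it is
    two-sided. *)
Lemma algebra_group_inv (g : fA) : g \in algebra_group n ->
  g \is a GRing.unit /\ g^-1 \in algebra_group n.
Proof.
have U1 : (1 : fA) \in algebra_group n by rewrite inE subrr mem0v.
have rinv (u : fA) : u \in algebra_group n ->
    exists2 v : fA, v \in algebra_group n & u * v = 1.
  move=> Uu; have inj_u : injective ( *%R u).
    suff u_reg (Y : fA) : u * Y = 0 -> Y = 0.
      move=> Y Z eqYZ; apply: subr0_eq; apply: u_reg.
      by rewrite mulrBr eqYZ subrr.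
    move=> uY0; have [_ [k nk0]] := nil_n.
    have YE i : Y = (1 - u) ^+ i * Y.
      elim: i => [|i IHi]; first by rewrite mul1r.
      by rewrite exprSr -mulrA [(1 - u) * Y]mulrBl uY0 mul1r subr0.
    suff Xk0 : ((1 - u : A) ^+ k) = 0 by rewrite (YE k) [_ ^+ k]Xk0 mul0r.
    have nX : (1 - u : A) \in n by rewrite -opprB memvN; rewrite inE in Uu.
    apply/eqP; rewrite -memv0 -nk0.
    elim: k {nk0} => [|k IHk]; first by rewrite expr0 expv0 memv_line.
    by rewrite exprS expvSl memv_mul.
  have uUU : [set u * v | v in algebra_group n] = algebra_group n.
    apply/eqP; rewrite eqEcard card_imset // leqnn andbT.
    by apply/subsetP => _ /imsetP[v Uv ->]; apply: algebra_group_mul.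
  have := U1; rewrite -{1}uUU => /imsetP[v Uv uv1]; by exists v.
move=> /[dup] Ug /rinv[h Uh gh1]; have [g' _ hg'1] := rinv h Uh.
have hg1 : h * g = 1 by rewrite -[g]mulr1 -hg'1 (mulrA g) gh1 mul1r.
have unit_g : g \is a GRing.unit by apply/unitrP; exists h.
by split=> //; rewrite -[g^-1]mulr1 -gh1 mulKr.
Qed.

Definition unipotent_set : {set {unit fA}} :=
  [set u : {unit fA} | FinRing.uval u \in algebra_group n].

Lemma unipotent_set_group_set : group_set unipotent_set.
Proof.
have memU u : (u \in unipotent_set) = (FinRing.uval u \in algebra_group n).
  by rewrite inE.
apply/group_setP; split=> [|u v]; first by rewrite !inE subrr mem0v.
by rewrite !memU; apply: algebra_group_mul.
Qed.

Definition unipotent_group : {group {unit fA}} := Group unipotent_set_group_set.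

Lemma mem_unipotent_group u :
  (u \in unipotent_group) = (FinRing.uval u \in algebra_group n).
Proof. by rewrite inE. Qed.

Lemma algebra_groupE : algebra_group n = @FinRing.uval fA @: unipotent_group.
Proof.
apply/setP => g; apply/idP/imsetP => [Ug | [u]]; last first.
  by rewrite mem_unipotent_group => Uu ->.
have [unit_g _] := algebra_group_inv Ug.
by exists (FinRing.unit fA unit_g); rewrite ?mem_unipotent_group.
Qed.

Lemma card_unipotent_group : #|unipotent_group| = #|vset n|.
Proof.
rewrite -card_algebra_group algebra_groupE card_imset //; exact: val_inj.
Qed.

Lemma big_algebra_group (M : nmodType) (f : fA -> M) :
  \sum_(g in algebra_group n) f g =
  \sum_(u in unipotent_group) f (FinRing.uval u).
Proof. by rewrite algebra_groupE big_imset //= => u v _ _; apply: val_inj. Qed.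

End Group.
End Unipotent.

(** * The two-sided action on the dual space *)

Section Duals.

Variables (F : finFieldType) (A : falgType F).
Local Notation fA := (finvect_type A).
Implicit Types (n m V : {vspace A}).

Lemma devalD V (lam : dual V) : {morph deval lam : X Y / X + Y}.
Proof. by move=> X Y; rewrite /deval !linearD. Qed.

Lemma devalZ V (lam : dual V) a : {morph deval lam : X / a *: X >-> a * X}.
Proof. by move=> X; rewrite /deval !linearZ. Qed.

Lemma devalB V (lam : dual V) : {morph deval lam : X Y / X - Y}.
Proof. by move=> X Y; rewrite /deval !linearB. Qed.

Lemma dual_ext V (lam mu : dual V) :
  {in V, deval lam =1 deval mu} -> lam = mu.
Proof.
move=> eq_lm; apply/lfunP => x; have := eq_lm (vsval x) (subvsP x).
by rewrite /deval vsvalK.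
Qed.

Lemma linfunE V (f : A -> F) :
    {morph f : X Y / X + Y} -> (forall a, {morph f : X / a *: X >-> a * X}) ->
  {in V, deval (linfun (fun X : subvs_of V => f (vsval X) : F^o) : dual V)
         =1 f}.
Proof.
move=> fD fZ X VX; pose g (x : subvs_of V) : F^o := f (vsval x).
have g_lin : linear g by move=> a x y; rewrite /g linearP fD fZ.
pose L := HB.pack_for {linear subvs_of V -> F^o} g
  (GRing.isLinear.Build _ _ _ _ g g_lin).
by rewrite /deval (lfunE L) /= /g vsprojK.
Qed.

Lemma deval_lact V g (lam : dual V) X :
  X \in V -> deval (lact g lam) X = deval lam (g^-1 * X).
Proof.
move=> VX; apply: (linfunE (f := fun Y => deval lam (g^-1 * Y))) => //.
  by move=> Y Z; rewrite mulrDr devalD.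
by move=> a Y; rewrite -scalerAr devalZ.
Qed.

Lemma deval_ract V (lam : dual V) g X :
  X \in V -> deval (ract lam g) X = deval lam (X * g^-1).
Proof.
move=> VX; apply: (linfunE (f := fun Y => deval lam (Y * g^-1))) => //.
  by move=> Y Z; rewrite mulrDl devalD.
by move=> a Y; rewrite -scalerAl devalZ.
Qed.

Lemma deval_restr n m (lam : dual n) X :
  X \in m -> deval (dual_restr m lam) X = deval lam X.
Proof. by apply: linfunE => [Y Z | a Y]; rewrite (devalD, devalZ). Qed.

(** Stability on both sides at once is what makes the functional
    X |-> lam (g X h) depend only on the values of lam on V. *)
Definition bistable n V : Prop :=
  forall (g h : fA) (X : A),
    g \in algebra_group n -> h \in algebra_group n -> X \in V ->
  (g : A) * X * (h : A) \in V.

Section Action.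

Variables n V : {vspace A}.
Hypotheses (nil_n : nilpotent_algebra n) (stV : bistable n V).
Local Notation U := (unipotent_group nil_n).
Local Notation uval := (@FinRing.uval fA).

(** An [action] is a right action, so the pair (u, v) acts by
    X |-> lam (u X v^-1); replacing u by u^-1 does not change orbits of groups.
    Outside U x U the identity is used because an action must be injective for
    every group element. *)
Definition dual_act (lam : dual V) (a : {unit fA} * {unit fA}) : dual V :=
  if a \in setX U U then ract (lact (uval a.1)^-1 lam) (uval a.2) else lam.

Lemma bistable_unit u v X : u \in U -> v \in U -> X \in V ->
  (uval u : A) * X * uval v \in V.
Proof. by rewrite !mem_unipotent_group; apply: stV. Qed.

Lemma deval_dual_act lam u v X : u \in U -> v \in U -> X \in V ->
  deval (dual_act lam (u, v)) X =
  deval lam ((uval u : A) * X * (uval v : A)^-1).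
Proof.
move=> Uu Uv VX; rewrite /dual_act in_setX Uu Uv deval_ract //=.
have := bistable_unit (group1 U) (groupVr Uv) VX.
rewrite /= mul1r => VXv; rewrite deval_lact // invrK.
by rewrite (mulrA (uval u : A)).
Qed.

Lemma dual_act_is_action : is_action (setX U U) dual_act.
Proof.
have UUP u v : (u, v) \in setX U U -> u \in U /\ v \in U.
  by rewrite in_setX => /andP.
have actM x : {in setX U U &, act_morph dual_act x}.
  move=> -[u v] [u' v'] /UUP[Uu Uv] /UUP[Uu' Uv'].
  apply: dual_ext => X VX.
  rewrite (deval_dual_act x (groupM Uu Uu') (groupM Uv Uv') VX) /=.
  have := bistable_unit Uu' (groupVr Uv') VX; rewrite /= => VX'.
  rewrite !deval_dual_act //.
  have -> : (uval v * uval v' : A)^-1 = (uval v' : A)^-1 * (uval v : A)^-1.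
    by apply: (@invrM A); [exact: (valP v) | exact: (valP v')].
  by rewrite !mulrA.
split=> // a; have [Da | /negPf nDa] := boolP (a \in setX U U); last first.
  by move=> x y; rewrite /dual_act nDa.
apply: (can_inj (g := dual_act^~ a^-1%g)) => x.
rewrite -actM ?groupV // mulgV; apply: dual_ext => X VX.
by rewrite deval_dual_act ?group1 //= mul1r invr1 mulr1.
Qed.

Definition dual_action := Action dual_act_is_action.

End Action.
End Duals.

(** * Orbits and stabilizers *)

Section Orbits.

Variables (F : finFieldType) (A : falgType F) (n V p : {vspace A}).
Local Notation fA := (finvect_type A).
Local Notation uval := (@FinRing.uval fA).
Hypotheses (nil_n : nilpotent_algebra n) (nil_p : nilpotent_algebra p).
Hypotheses (stV : bistable n V) (sub_pn : (p <= n)%VS).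
Local Notation U := (unipotent_group nil_n).
Local Notation P := (unipotent_group nil_p).
Local Notation to := (dual_action nil_n stV).

Lemma unipotent_groupS : P \subset U.
Proof.
apply/subsetP => u; rewrite !mem_unipotent_group !inE.
exact: (subvP sub_pn).
Qed.

Lemma unipotent_setXS : setX P P \subset setX U U.
Proof. by apply: setXS; apply: unipotent_groupS. Qed.

Let PU u : u \in P -> u \in U.
Proof. exact: (subsetP unipotent_groupS). Qed.

Lemma left_orbitE lam : left_orbit p lam = orbit to (setX P 1%g) lam.
Proof.
have actE u : u \in P -> lact (uval u)^-1 lam = to lam (u, 1%g).
  move=> Pu; apply: dual_ext => X VX; rewrite deval_dual_act ?group1 ?PU //.
  by rewrite deval_lact // invrK /= invr1 mulr1.
rewrite /left_orbit algebra_groupE -imset_comp; apply/setP => mu.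
apply/imsetP/imsetP => [[u Pu ->] | [[u v]]].
  exists (u^-1, 1)%g; first by rewrite mem_setX groupV Pu group1.
  by rewrite -actE ?groupV //= invrK.
rewrite mem_setX => /andP[Pu /set1P->] ->; exists (u^-1)%g.
  by rewrite groupV.
by rewrite -actE.
Qed.

Lemma two_sided_orbitE lam : two_sided_orbit p lam = orbit to (setX P P) lam.
Proof.
have actE u v : u \in P -> v \in P ->
    ract (lact (uval u)^-1 lam) (uval v) = to lam (u, v).
  by move=> Pu Pv; rewrite /= /dual_act mem_setX !PU.
apply/setP => mu; apply/imset2P/imsetP => [[g h] | [[u v]]].
  rewrite !algebra_groupE => /imsetP[u Pu ->] /imsetP[v Pv ->] ->.
  exists (u^-1, v)%g; first by rewrite mem_setX groupV Pu Pv.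
  by rewrite -actE ?groupV //= invrK.
rewrite mem_setX => /andP[Pu Pv] ->; rewrite -actE //.
by exists (uval u^-1%g) (uval v); rewrite // -mem_unipotent_group ?groupV.
Qed.

Lemma astab_dualP lam u v : u \in U -> v \in U ->
  reflect {in V, forall X, deval lam ((uval u : A) * X * (uval v : A)^-1) =
                           deval lam X}
          ((u, v) \in 'C[lam | to]%g).
Proof.
move=> Uu Uv; rewrite in_setI mem_setX Uu Uv inE sub1set inE.
apply: (iffP eqP) => [fix_lam X VX | fix_lam].
  by rewrite -[in RHS]fix_lam deval_dual_act.
by apply: dual_ext => X VX; rewrite deval_dual_act // fix_lam.
Qed.

(* u |-> u - 1 identifies the algebra group with the algebra itself. *)
Let card_stabilizer (Q : pred fA) (S : {set {unit fA}}) :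
    {in P, forall u, (u \in S) = Q (uval u - 1)} ->
  #|P :&: S| = #|[set X in vset p | Q X]|.
Proof.
move=> SQ; have inj_sub1 : injective (fun u : {unit fA} => uval u - 1).
  by move=> u v /addIr /val_inj.
rewrite -(card_imset _ inj_sub1); apply: eq_card => X; rewrite inE.
apply/imsetP/andP => [[u] | [pX QX]].
  rewrite in_setI => /andP[Pu]; rewrite SQ // => Qu ->; split=> //.
  by move: Pu; rewrite mem_unipotent_group !inE.
have : X + 1 \in algebra_group p by rewrite inE addrK; rewrite inE in pX.
rewrite (algebra_groupE nil_p) => /imsetP[u Pu Xu]; exists u.
  by rewrite in_setI Pu SQ // -Xu addrK.
by rewrite -Xu addrK.
Qed.

(** u = 1 + X fixes lam on the left exactly when lam (X Y) = 0 for all Y in V, so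
    the stabilizer is 1 + (left kernel of this form on p x V). *)
Lemma card_left_stabilizer (lam : dual V) :
  #|P :&: lslice 'C[lam | to]| =
  #|[set X in vset p | [forall Y in vset V, deval lam ((X : A) * Y) == 0]]|.
Proof.
apply: card_stabilizer => u Pu; rewrite mem_lslice.
have fixE (Y : A) :
    (deval lam ((uval u - 1 : A) * Y) == 0) =
    (deval lam ((uval u : A) * Y) == deval lam Y).
  by rewrite mulrBl mul1r devalB subr_eq0.
apply/(astab_dualP _ (PU Pu) (group1 U))/forall_inP => fix_lam Y.
  rewrite inE fixE => VY; have := fix_lam Y VY.
  by rewrite /= invr1 mulr1 => ->.
move=> VY; rewrite /= invr1 mulr1; apply/eqP; rewrite -fixE.
by apply: fix_lam; rewrite inE.
Qed.

Lemma card_right_stabilizer (lam : dual V) :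
  #|P :&: rslice 'C[lam | to]| =
  #|[set Y in vset p | [forall X in vset V, deval lam ((X : A) * Y) == 0]]|.
Proof.
apply: card_stabilizer => u Pu; rewrite mem_rslice.
have fixE (X : A) :
    (deval lam (X * (uval u - 1 : A)) == 0) =
    (deval lam (X * (uval u : A)) == deval lam X).
  by rewrite mulrBr mulr1 devalB subr_eq0.
have -> : ((1%g, u) \in 'C[lam | to]%g) = ((1%g, u^-1%g) \in 'C[lam | to]%g).
  by rewrite -groupV -[in RHS](invg1 {unit fA}).
apply/(astab_dualP _ (group1 U) (groupVr (PU Pu)))/forall_inP => fix_lam X.
  rewrite inE fixE => VX; have := fix_lam X VX.
  by rewrite /= mul1r invrK => ->.
move=> VX; rewrite /= mul1r invrK; apply/eqP; rewrite -fixE.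
by apply: fix_lam; rewrite inE.
Qed.

Lemma card_left_orbit (lam : dual V) :
  (#|left_orbit p lam| * #|P :&: lslice 'C[lam | to]|)%N = #|vset p|.
Proof.
rewrite left_orbitE -(card_unipotent_group nil_p).
have sub1 : setX P 1%g \subset setX U U.
  by apply: setXS; rewrite ?sub1G ?unipotent_groupS.
have := card_orbit_in_stab to lam sub1.
by rewrite setI_setX1l !cardsX cards1 !muln1.
Qed.

Lemma card_two_sided_orbit (lam : dual V) :
  (#|two_sided_orbit p lam| * #|setX P P :&: 'C[lam | to]%g|)%N =
  (#|vset p| * #|vset p|)%N.
Proof.
rewrite two_sided_orbitE -(card_unipotent_group nil_p) -[RHS]cardsX.
exact: (card_orbit_in_stab to lam unipotent_setXS).
Qed.

Lemma two_sided_orbit_mean (C : numFieldType) (f : dual V -> C) (lam : dual V) :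
  (\sum_(mu in two_sided_orbit p lam) f mu) / #|two_sided_orbit p lam|%:R =
  (\sum_(a in setX P P) f (to lam a)) / #|setX P P|%:R.
Proof. by rewrite two_sided_orbitE; apply: (orbit_mean to unipotent_setXS). Qed.

Lemma mem_two_sided_orbit (lam : dual V) : lam \in two_sided_orbit p lam.
Proof. by rewrite two_sided_orbitE; apply: orbit_refl. Qed.

Lemma two_sided_orbit_eq (lam mu : dual V) :
  mu \in two_sided_orbit p lam -> two_sided_orbit p mu = two_sided_orbit p lam.
Proof.
rewrite !two_sided_orbitE => /orbitP[a Pa <-].
by apply: orbit_act_in Pa; apply: unipotent_setXS.
Qed.

Lemma two_sided_orbit_gt0 (lam : dual V) : (0 < #|two_sided_orbit p lam|)%N.
Proof. by apply/card_gt0P; exists lam; apply: mem_two_sided_orbit. Qed.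

Lemma left_orbit_gt0 (lam : dual V) : (0 < #|left_orbit p lam|)%N.
Proof.
by apply/card_gt0P; exists lam; rewrite left_orbitE; apply: (orbit_refl to).
Qed.

End Orbits.

(** * Stability and supercharacters *)

Section Stability.

Variables (F : finFieldType) (A : falgType F).
Local Notation fA := (finvect_type A).
Implicit Types (n m V : {vspace A}).

Lemma bistable_self n : nilpotent_algebra n -> bistable n n.
Proof.
move=> nil_n g h X; rewrite !inE => ng nh nX.
have nM := nilpotent_algebra_mul nil_n.
have ngX : (g : A) * X \in n.
  by rewrite -[g : A](subrK 1) mulrDl mul1r memvD ?nM.
by rewrite -[h : A](subrK 1) mulrDr mulr1; apply: memvD => //; apply: nM.
Qed.

(** If 1 + X is in the superclass of z, then so is 1 + g X h. *)
Lemma supernormal_bistable n m : nilpotent_algebra n ->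
  supernormal n (algebra_group m) -> bistable n m.
Proof.
move=> nil_n [_ _ _ [S _ mE]] g h X ng nh mX.
have : 1 + (X : fA) \in algebra_group m by rewrite inE addrC addKr.
rewrite mE => /bigcupP[z Sz /imset2P[x y nx ny /addrI XE]].
suff : 1 + ((g : A) * X * h : fA) \in algebra_group m.
  by rewrite inE addrC addKr.
rewrite mE; apply/bigcupP; exists z => //.
apply/imset2P; exists (g * x) (y * h); rewrite ?(algebra_group_mul nil_n) //.
by rewrite [X]XE !mulrA.
Qed.

Lemma card_vset (V : {vspace A}) : #|vset V| = (#|F| ^ \dim V)%N.
Proof. by rewrite cardsE (card_vspace (V : {vspace fA})). Qed.

Lemma pnat_leq_dvdn p x y :
  prime p -> p.-nat x -> p.-nat y -> (x <= y)%N -> (x %| y)%N.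
Proof.
move=> pr_p /p_natP[i ->] /p_natP[j ->].
by rewrite leq_exp2l ?prime_gt1 // => /dvdn_exp2l.
Qed.

Lemma card_finField_pnat : {p | prime p & p.-nat #|F|}.
Proof.
have [p pr_p charFp] := finPcharP F; exists p => //.
have := fin_ring_pchar_abelem charFp => /abelem_pgroup.
by rewrite /pgroup cardsT.
Qed.

End Stability.

Section Supercharacters.

Variables (F : finFieldType) (A : falgType F).
Variables (C : numClosedFieldType) (theta : F -> C) (p : {vspace A}).
Local Notation fA := (finvect_type A).
Hypothesis theta_char : nontrivial_additive_character theta.
Hypothesis nil_p : nilpotent_algebra p.
Let st_p := bistable_self nil_p.

Lemma supercharacter1 (nu : dual p) :
  supercharacter theta nu 1 = #|left_orbit p nu|%:R.
Proof.
have U1 : (1 : fA) \in algebra_group p by rewrite inE subrr mem0v.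
rewrite ffunE U1 (eq_bigr (fun=> 1)) => [|mu _]; last first.
  by rewrite subrr /deval !linear0 (theta_0 theta_char).
rewrite sumr_const divfK // pnatr_eq0 -lt0n.
exact: (two_sided_orbit_gt0 nil_p nil_p st_p (subvv p)).
Qed.

(** The coefficient of the character theta o nu of the additive group p in
    X |-> supercharacter mu (1 + X) is nonzero exactly when nu lies in the orbit
    of mu. *)
Lemma supercharacter_inj (nu nu' : dual p) :
  supercharacter theta nu = supercharacter theta nu' ->
  nu \in two_sided_orbit p nu'.
Proof.
pose coef (mu : dual p) : C := \sum_(X in vset p)
  theta (- deval nu X) * supercharacter theta mu (1 + X).
have coefE mu : coef mu = if nu \in two_sided_orbit p mu then
    #|left_orbit p mu|%:R / #|two_sided_orbit p mu|%:R * #|vset p|%:R else 0.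
  have -> : coef mu = #|left_orbit p mu|%:R / #|two_sided_orbit p mu|%:R *
      \sum_(ka in two_sided_orbit p mu) \sum_(X in vset p)
         theta (deval ka X - deval nu X).
    rewrite exchange_big big_distrr; apply: eq_bigr => X pX /=.
    have UX : 1 + X \in algebra_group p.
      by rewrite inE addrC addKr; rewrite inE in pX.
    rewrite ffunE UX mulrCA; congr (_ * _); rewrite big_distrr /=.
    apply: eq_bigr => ka _; rewrite -(theta_add theta_char) addrC.
    by rewrite [1 + X]addrC addrK.
  have inner ka : \sum_(X in vset p) theta (deval ka X - deval nu X) =
      if ka == nu then #|vset p|%:R else 0.
    rewrite (@sum_theta _ _ _ theta_char A p (fun X => deval ka X - deval nu X)).
    - congr (if _ then _ else _); apply/forall_inP/eqP => [eq_kn | -> X _].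
        apply: dual_ext => X pX; apply/eqP; rewrite -subr_eq0.
        by apply: eq_kn; rewrite inE.
      by rewrite subrr.
    - by move=> X Y; rewrite !devalD opprD addrACA.
    - by move=> a X; rewrite !devalZ mulrBr.
  case: ifPn => [nu_mu | nu_mu].
    rewrite (bigD1 nu) //= inner eqxx big1 ?addr0 // => ka /andP[_ /negPf].
    by rewrite inner => ->.
  rewrite big1 ?mulr0 // => ka ka_mu; rewrite inner; case: eqP => // eq_ka.
  by rewrite -eq_ka ka_mu in nu_mu.
move=> eq_chi; have : coef nu = coef nu' by rewrite /coef eq_chi.
rewrite !coefE (mem_two_sided_orbit nil_p nil_p st_p (subvv p)).
case: ifP => // _ /eqP; rewrite !mulf_eq0 invr_eq0 !pnatr_eq0.
rewrite !eqn0Ngt (left_orbit_gt0 nil_p nil_p st_p (subvv p)).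
rewrite (two_sided_orbit_gt0 nil_p nil_p st_p (subvv p)) /=.
by rewrite -(card_unipotent_group nil_p) cardG_gt0.
Qed.

End Supercharacters.

(** * Restriction to m and the size of the multiplicity *)

(** The arithmetic of [leq_orbit_cards]. Here a, b, c, d are the orbit sizes
    |U lam|, |H mu|, |U mu U|, |H mu H| and sa, sh, k, k' the orders of the
    corresponding stabilizers; sb and sr are the orders of the left and the right
    stabilizer of mu in U, sl that of the left stabilizer of lam in H, and
    g = |n|, h = |m|. *)
Lemma leq_orbit_arith (a b c d sa sb sl sr sh k k' h g : nat) :
    (a * sa = g -> b * sh = h -> c * k = g * g -> d * k' = h * h ->
     sh * sa <= sb * sl -> k' * (sb * sr) <= k * (sh * sh) -> h * sr = g * sl ->
     0 < sa -> 0 < sh -> 0 < k -> 0 < k' -> 0 < sb -> 0 < sr ->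
   b * c <= a * d)%N.
Proof.
move=> ag bh cg dh le1 le2 dual sa0 sh0 k0 k'0 sb0 sr0.
have le3 : (g * sa * k' <= h * sh * k)%N.
  rewrite -(leq_pmul2r (m := sb * sr)) ?muln_gt0 ?sb0 //.
  have -> : (g * sa * k' * (sb * sr) = g * sa * (k' * (sb * sr)))%N by ring.
  apply: (leq_trans (leq_mul (leqnn _) le2)).
  have -> : (g * sa * (k * (sh * sh)) = g * k * sh * (sh * sa))%N by ring.
  apply: (leq_trans (leq_mul (leqnn _) le1)).
  have -> : (g * k * sh * (sb * sl) = k * sh * sb * (g * sl))%N by ring.
  by rewrite -dual leq_eqVlt; apply/orP; left; apply/eqP; ring.
rewrite -(leq_pmul2r (m := sh * k * sa * k')) ?muln_gt0 ?sh0 ?k0 ?sa0 //.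
have -> : (b * c * (sh * k * sa * k') = (b * sh) * (c * k) * (sa * k'))%N by ring.
have -> : (a * d * (sh * k * sa * k') = (a * sa) * (d * k') * (sh * k))%N by ring.
rewrite ag bh cg dh.
have -> : (h * (g * g) * (sa * k') = h * g * (g * sa * k'))%N by ring.
have -> : (g * (h * h) * (sh * k) = h * g * (h * sh * k))%N by ring.
by rewrite leq_mul2l le3 orbT.
Qed.

Section RestrictionSuperinduction.

Variables (F : finFieldType) (A : falgType F).
Variables (C : numClosedFieldType) (theta : F -> C) (n m : {vspace A}).
Local Notation fA := (finvect_type A).
Local Notation uval := (@FinRing.uval fA).
Hypothesis theta_char : nontrivial_additive_character theta.
Hypotheses (nil_n : nilpotent_algebra n) (nil_m : nilpotent_algebra m).
Hypotheses (sub_mn : (m <= n)%VS) (st_m : bistable n m).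
Let st_n := bistable_self nil_n.
Local Notation U := (unipotent_group nil_n).
Local Notation H := (unipotent_group nil_m).
Local Notation ton := (dual_action nil_n st_n).
Local Notation tom := (dual_action nil_n st_m).

Lemma dual_restr_act (lam : dual n) a : a \in setX U U ->
  dual_restr m (ton lam a) = tom (dual_restr m lam) a.
Proof.
case: a => u v; rewrite mem_setX => /andP[Uu Uv].
apply: dual_ext => X mX; have nX := subvP sub_mn X mX.
rewrite deval_restr // !deval_dual_act // deval_restr //.
exact: (bistable_unit st_m Uu (groupVr Uv) mX).
Qed.

Lemma norm_unipotent : U \subset 'N(H)%g.
Proof.
apply/subsetP => u Uu; rewrite inE; apply/subsetP => _ /imsetP[h Hh ->].
rewrite mem_unipotent_group inE.
have -> : uval (h ^ u)%g - 1 =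
    (uval u^-1%g : A) * (uval h - 1 : A) * (uval u : A) :> A.
  rewrite mulrBr mulr1 mulrBl /= mulVr; last exact: (valP u).
  by rewrite -mulrA.
apply: (bistable_unit st_m (groupVr Uu) Uu).
by move: Hh; rewrite mem_unipotent_group inE.
Qed.

Lemma card_left_orbit_act (mu : dual m) a : a \in setX U U ->
  #|left_orbit m (tom mu a)| = #|left_orbit m mu|.
Proof.
move=> Da; rewrite !(left_orbitE nil_n nil_m st_m sub_mn).
have sD : setX H 1%g \subset setX U U.
  by apply: setXS; rewrite ?sub1G // (unipotent_groupS nil_n nil_m).
apply: (card_orbit_act_norm tom sD) => //.
case: a Da => u v; rewrite mem_setX => /andP[Uu Uv].
by apply: norm_setX; [apply: (subsetP norm_unipotent) | rewrite norm1 inE].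
Qed.

Lemma card_two_sided_orbit_act (mu : dual m) a : a \in setX U U ->
  #|two_sided_orbit m (tom mu a)| = #|two_sided_orbit m mu|.
Proof.
move=> Da; rewrite !(two_sided_orbitE nil_n nil_m st_m sub_mn).
have sD := unipotent_setXS nil_n nil_m sub_mn.
apply: (card_orbit_act_norm tom sD) => //.
case: a Da => u v; rewrite mem_setX => /andP[Uu Uv].
by apply: norm_setX; apply: (subsetP norm_unipotent).
Qed.

(** Both sides are means over U x U, and restriction is equivariant. *)
Lemma orbit_mean_restr (f : dual m -> C) (lam : dual n) :
  (\sum_(la in two_sided_orbit n lam) f (dual_restr m la)) /
    #|two_sided_orbit n lam|%:R =
  (\sum_(nu in two_sided_orbit n (dual_restr m lam)) f nu) /
    #|two_sided_orbit n (dual_restr m lam)|%:R.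
Proof.
rewrite !(two_sided_orbit_mean nil_n nil_n _ (subvv n)).
congr (_ / _); apply: eq_bigr => a Da.
by rewrite dual_restr_act.
Qed.

Lemma supercharacter_restr (lam : dual n) g : g \in algebra_group m ->
  supercharacter theta lam g =
  #|left_orbit n lam|%:R / #|two_sided_orbit n (dual_restr m lam)|%:R *
    \sum_(nu in two_sided_orbit n (dual_restr m lam)) theta (deval nu (g - 1)).
Proof.
rewrite inE => mg; have ng : g \in algebra_group n.
  by rewrite inE (subvP sub_mn).
rewrite ffunE ng -!mulrA ![_^-1 * _]mulrC.
rewrite -(orbit_mean_restr (fun nu => theta (deval nu (g - 1)))).
congr (_ * (_ / _)); apply: eq_bigr => la _.
by rewrite deval_restr.
Qed.

Lemma two_sided_orbit_sub (mu nu : dual m) :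
  nu \in two_sided_orbit n mu ->
  two_sided_orbit m nu \subset two_sided_orbit n mu.
Proof.
move=> nu_mu; rewrite -(two_sided_orbit_eq nil_n nil_n st_m (subvv n) nu_mu).
rewrite (two_sided_orbitE nil_n nil_m st_m sub_mn).
rewrite (two_sided_orbitE nil_n nil_n st_m (subvv n)).
exact: imsetS (unipotent_setXS nil_n nil_m sub_mn).
Qed.

Lemma two_sided_orbit_cards (mu nu : dual m) : nu \in two_sided_orbit n mu ->
  #|left_orbit m nu| = #|left_orbit m mu| /\
  #|two_sided_orbit m nu| = #|two_sided_orbit m mu|.
Proof.
rewrite (two_sided_orbitE nil_n nil_n st_m (subvv n)) => /orbitP[a Da <-].
by rewrite card_left_orbit_act ?card_two_sided_orbit_act.
Qed.


(** With r(V, W) the rank of the form lam (X Y) on V x W, this is the Frobenius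
    rank inequality r(n, n) + r(m, m) >= r(n, m) + r(m, n), combined with the fact
    that H mu /\ mu H lies in U mu /\ mu U. *)
Lemma leq_orbit_cards (lam : dual n) (mu := dual_restr m lam) :
  (#|left_orbit m mu| * #|two_sided_orbit n mu| <=
   #|left_orbit n lam| * #|two_sided_orbit m mu|)%N.
Proof.
pose Cm := astab_group tom [set mu]; pose Cn := astab_group ton [set lam].
have mMn X Y : X \in m -> Y \in n -> X * Y \in m.
  move=> mX nY; have -> : X * Y = (1 : A) * X * (1 + Y : A) - X.
    by rewrite mul1r mulrDr mulr1 addrC addKr.
  apply: memvB => //; apply: (st_m (g := 1) (h := 1 + Y)) => //.
    by rewrite inE subrr mem0v.
  by rewrite inE addrC addKr.
have sHU := unipotent_groupS nil_n nil_m sub_mn.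
have sCU : U :&: lslice Cm = lslice Cm.
  apply/setIidPr/subsetP => u; rewrite mem_lslice => /astab_dom.
  by rewrite mem_setX => /andP[].
have sCU' : U :&: rslice Cm = rslice Cm.
  apply/setIidPr/subsetP => u; rewrite mem_rslice => /astab_dom.
  by rewrite mem_setX => /andP[].
have sCD : setX U U :&: Cm = Cm.
  by apply/setIidPr/subsetP => u /astab_dom.
have ag := card_left_orbit nil_n nil_n st_n (subvv n) lam.
have bh := card_left_orbit nil_n nil_m st_m sub_mn mu.
have cg := card_two_sided_orbit nil_n nil_n st_m (subvv n) mu.
have dh := card_two_sided_orbit nil_n nil_m st_m sub_mn mu.
have sN : U :&: lslice Cn \subset U :&: lslice Cm.
  apply/subsetP => u /setIP[Uu]; rewrite mem_lslice => Cu.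
  apply/setIP; split=> //; rewrite mem_lslice.
  have Du : (u, 1%g) \in setX U U by rewrite mem_setX Uu group1.
  rewrite in_setI Du inE sub1set inE -dual_restr_act //.
  by rewrite (astab_act Cu (set11 lam)) eqxx.
have HUI (S : {set {unit fA}}) : U :&: S :&: H = H :&: S.
  by rewrite setIAC (setIidPr sHU).
(* The part r(n, n) + r(m, m) >= r(n, m) + r(m, n), for left stabilizers. *)
have le1 : (#|H :&: lslice Cm| * #|U :&: lslice Cn| <=
            #|lslice Cm| * #|H :&: lslice Cn|)%N.
  rewrite -!HUI -[in X in (_ <= X * _)%N]sCU; exact: leq_card_setI sN.
have le2 := leq_card_slices Cm H.
have mulD V (la : dual V) (X : A) :
    {morph (fun Y => deval la (X * Y)) : Y Z / Y + Z}.
  by move=> Y Z; rewrite mulrDr devalD.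
have mulZ V (la : dual V) (X : A) a :
    {morph (fun Y => deval la (X * Y)) : Y / a *: Y >-> a * Y}.
  by move=> Y; rewrite -scalerAr devalZ.
have mulDl V (la : dual V) (Y : A) :
    {morph (fun X => deval la (X * Y)) : X Z / X + Z}.
  by move=> X Z; rewrite mulrDl devalD.
have mulZl V (la : dual V) (Y : A) a :
    {morph (fun X => deval la (X * Y)) : X / a *: X >-> a * X}.
  by move=> X; rewrite -scalerAl devalZ.
(* Row rank equals column rank, on m x n and then on m x m. *)
have dual_mn : (#|vset m| * #|rslice Cm| = #|vset n| * #|H :&: lslice Cn|)%N.
  rewrite -sCU' (card_right_stabilizer nil_n nil_n st_m (subvv n) mu).
  rewrite (card_left_stabilizer nil_n nil_m st_n sub_mn lam).
  rewrite -(bilinear_kernels theta_char m n (mulD _ lam) (mulZ _ lam)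
    (mulDl _ lam) (mulZl _ lam)).
  congr (_ * _)%N; apply: eq_card => Y; rewrite !inE.
  case: (boolP (Y \in n)) => //= nY.
  apply: eq_forallb_in => X; rewrite inE => mX.
  by rewrite deval_restr // mMn.
have dual_mm : #|rslice Cm :&: H| = #|H :&: lslice Cm|.
  rewrite setIC (card_right_stabilizer nil_n nil_m st_m sub_mn mu).
  rewrite (card_left_stabilizer nil_n nil_m st_m sub_mn mu).
  have m_gt0 : (0 < #|vset m|)%N.
    by rewrite -(card_unipotent_group nil_m) cardG_gt0.
  apply/eqP; rewrite -(eqn_pmul2l m_gt0); apply/eqP.
  exact: (bilinear_kernels theta_char m m (mulD _ mu) (mulZ _ mu)
    (mulDl _ mu) (mulZl _ mu)).
rewrite sCD in cg; rewrite [lslice Cm :&: H]setIC dual_mm in le2.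
rewrite setIC in le2.
apply: (leq_orbit_arith ag bh cg dh le1 le2 dual_mn); exact: cardG_gt0.
Qed.

End RestrictionSuperinduction.

(** * Fibres of the restriction of functionals *)

Section DualSpaces.

Variables (F : finFieldType) (A : falgType F) (n m : {vspace A}).
Hypothesis sub_mn : (m <= n)%VS.

Lemma dual_restrK (nu : dual m) : dual_restr m (dual_restr n nu) = nu.
Proof.
by apply: dual_ext => X mX; rewrite !deval_restr // (subvP sub_mn).
Qed.

(** [dual V] is only a finite type, so addition goes through the underlying
    space of linear maps. *)
Definition dual_add (V : {vspace A}) (lam ka : dual V) : dual V :=
  ((lam : 'Hom(subvs_of V, F^o)) + ka)%R.

Lemma dual_add_inj (V : {vspace A}) (ka : dual V) :
  injective (fun lam => dual_add lam ka).
Proof. exact: addIr. Qed.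

Lemma deval_add (V : {vspace A}) (lam ka : dual V) X :
  deval (dual_add lam ka) X = deval lam X + deval ka X.
Proof. by rewrite /deval add_lfunE. Qed.

Lemma dual_restr_add (lam ka : dual n) :
  dual_restr m (dual_add lam ka) =
  dual_add (dual_restr m lam) (dual_restr m ka).
Proof.
by apply: dual_ext => X mX; rewrite deval_add !deval_restr // deval_add.
Qed.

Lemma card_dual (V : {vspace A}) : #|dual V| = #|vset V|.
Proof.
pose dualV := finvect_type 'Hom(subvs_of V, F^o).
rewrite card_vset -(card_vspacef (Vector.class dualV)).
rewrite card_vspace dimvf; congr (_ ^ _)%N; exact: muln1.
Qed.

(** Compose a coordinate form that does not vanish at X - proj X with the
    projection along m. *)
Lemma dual_extra_value X b : X \in n -> X \notin m ->
  exists2 ka : dual n, {in m, deval ka =1 fun=> 0} & deval ka X = b.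
Proof.
move=> nX nmX; pose Z := X - projv m X.
have Z_neq0 : Z != 0.
  by apply: contra nmX; rewrite subr_eq0 => /eqP->; apply: memv_proj.
have [i coordZ] : exists i, coord (vbasis {:A}) i Z != 0.
  apply/existsP; apply: contraR Z_neq0; rewrite negb_exists => /forallP coord0.
  rewrite [Z](coord_vbasis (memvf Z)) big1 // => i _.
  by have := coord0 i; rewrite negbK => /eqP->; rewrite scale0r.
pose c : F := b / coord (vbasis {:A}) i Z.
pose f Y : F := c * coord (vbasis {:A}) i (Y - projv m Y).
have fD : {morph f : Y Y' / Y + Y'}.
  by move=> Y Y'; rewrite /f (linearD (projv m)) opprD addrACA linearD mulrDr.
have fZ a : {morph f : Y / a *: Y >-> a * Y}.
  move=> Y; rewrite /f.
  have -> : projv m (a *: Y) = a *: projv m Y by rewrite linearZ.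
  by rewrite -scalerBr linearZ mulrCA.
exists (linfun (fun Y : subvs_of n => f (vsval Y) : F^o) : dual n).
  move=> Y mY; rewrite (linfunE fD fZ) ?(subvP sub_mn) //.
  by rewrite /f projv_id // subrr linear0 mulr0.
by rewrite (linfunE fD fZ) // /f divfK.
Qed.

(** The fibres are translates of one another and partition n^*. *)
Lemma card_restr_fibre (nu : dual m) :
  (#|[set lam : dual n | dual_restr m lam == nu]| * #|vset m| = #|vset n|)%N.
Proof.
pose fib (ka : dual m) := [set lam : dual n | dual_restr m lam == ka].
have fib_le ka ka' : (#|fib ka| <= #|fib ka'|)%N.
  pose de : dual m := ((ka' : 'Hom(subvs_of m, F^o)) - ka)%R.
  have kaD : dual_add ka de = ka' by rewrite /dual_add /de addrC subrK.
  rewrite -(card_imset _ (@dual_add_inj n (dual_restr n de))).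
  apply/subset_leq_card/subsetP => _ /imsetP[lam + ->]; rewrite !inE.
  by move=> /eqP lamE; rewrite dual_restr_add dual_restrK lamE kaD.
have fibE ka : #|fib ka| = #|fib nu| by apply/eqP; rewrite eqn_leq !fib_le.
rewrite -!card_dual -[RHS]sum1_card.
rewrite (partition_big (@dual_restr _ _ n m) predT) //=.
rewrite (eq_bigr (fun=> #|fib nu|)) => [|ka _].
  by rewrite sum_nat_const mulnC.
by rewrite -(fibE ka) -sum1_card; apply: eq_bigl => lam; rewrite inE.
Qed.

Lemma sum_restr_preimage (C : numFieldType) (S : {set dual m})
    (f : dual m -> C) :
  (\sum_(lam : dual n | dual_restr m lam \in S) f (dual_restr m lam)) /
    #|vset n|%:R =
  (\sum_(nu in S) f nu) / #|vset m|%:R.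
Proof.
rewrite (partition_big (@dual_restr _ _ n m) [in S]) //= !mulr_suml.
apply: eq_bigr => nu Snu.
rewrite (eq_bigr (fun=> f nu)) => [|lam /andP[_ /eqP->] //].
rewrite sumr_const -[f nu *+ _]mulr_natr -(card_restr_fibre nu) natrM invfM.
have -> : #|[pred lam : dual n | (dual_restr m lam \in S) &&
                                 (dual_restr m lam == nu)]|
    = #|[set lam : dual n | dual_restr m lam == nu]|.
  apply: eq_card => lam; rewrite !inE.
  by case: eqP => [->|]; rewrite ?Snu ?andbF.
rewrite mulrA mulfK // pnatr_eq0 -lt0n; apply/card_gt0P.
by exists (dual_restr n nu); rewrite inE dual_restrK.
Qed.

End DualSpaces.

(** * Restriction and superinduction of supercharacters *)

Section Main.

Variables (F : finFieldType) (A : falgType F).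
Variables (C : numClosedFieldType) (theta : F -> C) (n m : {vspace A}).
Local Notation fA := (finvect_type A).
Local Notation uval := (@FinRing.uval fA).
Hypothesis theta_char : nontrivial_additive_character theta.
Hypotheses (nil_n : nilpotent_algebra n) (nil_m : nilpotent_algebra m).
Hypotheses (sub_mn : (m <= n)%VS) (st_m : bistable n m).
Let st_n := bistable_self nil_n.
Local Notation U := (unipotent_group nil_n).
Local Notation H := (unipotent_group nil_m).
Local Notation ton := (dual_action nil_n st_n).
Local Notation tom := (dual_action nil_n st_m).

Let tsm_neq0 (mu : dual m) : #|two_sided_orbit m mu|%:R != 0 :> C.
Proof.
by rewrite pnatr_eq0 -lt0n (two_sided_orbit_gt0 nil_n nil_m st_m sub_mn).
Qed.

Let tsn_neq0 (mu : dual m) : #|two_sided_orbit n mu|%:R != 0 :> C.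
Proof.
by rewrite pnatr_eq0 -lt0n (two_sided_orbit_gt0 nil_n nil_n st_m (subvv n)).
Qed.

Let lm_neq0 (mu : dual m) : #|left_orbit m mu|%:R != 0 :> C.
Proof.
by rewrite pnatr_eq0 -lt0n (left_orbit_gt0 nil_n nil_m st_m sub_mn).
Qed.

Lemma restr_supercharacter_transversal (lam : dual n) (R : {set dual m})
    (mu := dual_restr m lam) g :
    is_transversal R [set two_sided_orbit m nu | nu in two_sided_orbit n mu]
      (two_sided_orbit n mu) ->
    g \in algebra_group m ->
  supercharacter theta lam g =
  (#|left_orbit n lam|%:R * #|two_sided_orbit m mu|%:R) /
  (#|left_orbit m mu|%:R * #|two_sided_orbit n mu|%:R) *
  \sum_(nu in R) supercharacter theta nu g.
Proof.
move=> trR mg; have sRD := transversal_sub trR.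
rewrite (supercharacter_restr theta nil_n sub_mn st_m lam mg) -/mu.
rewrite (big_transversal_orbit _ trR) => [|nu _]; last first.
  exact: (mem_two_sided_orbit nil_n nil_m st_m sub_mn).
rewrite [in RHS](eq_bigr (fun nu =>
  #|left_orbit m mu|%:R / #|two_sided_orbit m mu|%:R *
  \sum_(ka in two_sided_orbit m nu) theta (deval ka (g - 1)))); last first.
  move=> nu Rnu; have := two_sided_orbit_cards nil_n nil_m sub_mn st_m.
  move=> /(_ mu nu (subsetP sRD nu Rnu))[<- <-].
  by rewrite ffunE mg.
rewrite -mulr_sumr mulrA; congr (_ * _).
by field; rewrite tsn_neq0 lm_neq0 tsm_neq0.
Qed.

Lemma two_sided_orbit_transversal (mu : dual m) : exists R : {set dual m},
  is_transversal R [set two_sided_orbit m nu | nu in two_sided_orbit n mu]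
    (two_sided_orbit n mu).
Proof.
set D := two_sided_orbit n mu.
have DE : D = orbit tom (setX U U) mu.
  exact: (two_sided_orbitE nil_n nil_n st_m (subvv n)).
have sHU := unipotent_setXS nil_n nil_m sub_mn.
have actsD : [acts setX H H, on D | tom].
  by rewrite DE; apply: subset_trans sHU (acts_orbit tom mu (subxx _)).
have := orbit_partition actsD.
have -> : orbit tom (setX_group H H) @: D =
          [set two_sided_orbit m nu | nu in D].
  by apply: eq_imset => nu; rewrite (two_sided_orbitE nil_n nil_m st_m sub_mn).
by move=> /transversalP trD; eexists; apply: trD.
Qed.

(** Every orbit size divides a power of the order of F, so the quotient is a
    power of the characteristic, with exponent in Z; [leq_orbit_cards] makes the
    exponent nonnegative. *)
Lemma restr_multiplicity (lam : dual n) (mu := dual_restr m lam) :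
  exists2 k, (0 < k)%N &
  (#|left_orbit n lam|%:R * #|two_sided_orbit m mu|%:R) /
  (#|left_orbit m mu|%:R * #|two_sided_orbit n mu|%:R) = k%:R :> C.
Proof.
have [p pr_p pF] := card_finField_pnat F.
have pV (V : {vspace A}) : p.-nat #|vset V| by rewrite card_vset pnatX pF.
have pl := card_left_orbit nil_n nil_n st_n (subvv n) lam.
have ptm := card_two_sided_orbit nil_n nil_m st_m sub_mn mu.
have plm := card_left_orbit nil_n nil_m st_m sub_mn mu.
have ptn := card_two_sided_orbit nil_n nil_n st_m (subvv n) mu.
have dvdp x y z : (x * y)%N = z -> p.-nat z -> p.-nat x.
  by move=> <-; apply: pnat_dvd; apply: dvdn_mulr.
have leq_c := leq_orbit_cards theta_char nil_n nil_m sub_mn st_m lam.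
have /dvdnP[k kE] : (#|left_orbit m mu| * #|two_sided_orbit n mu| %|
    #|left_orbit n lam| * #|two_sided_orbit m mu|)%N.
  apply: (pnat_leq_dvdn pr_p) leq_c; rewrite pnatM.
    by rewrite (dvdp _ _ _ plm) ?(dvdp _ _ _ ptn) ?pnatM ?pV.
  by rewrite (dvdp _ _ _ pl) ?(dvdp _ _ _ ptm) ?pnatM ?pV.
exists k; last first.
  by rewrite -!natrM kE natrM mulfK // natrM mulf_neq0 ?lm_neq0 ?tsn_neq0.
rewrite lt0n; apply/eqP => k0; move: kE; rewrite k0 mul0n => /eqP.
apply/negP; rewrite -lt0n muln_gt0.
rewrite (left_orbit_gt0 nil_n nil_n st_n (subvv n)).
by rewrite (two_sided_orbit_gt0 nil_n nil_m st_m sub_mn).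
Qed.

Lemma restr_supercharacter_decomposition (lam : dual n)
    (mu := dual_restr m lam) :
  exists (s : seq {ffun finvect_type A -> C}) (d : C) (k : nat),
    [/\ uniq s,
        (size s)%:R = #|two_sided_orbit n mu|%:R /
                      #|two_sided_orbit m mu|%:R :> C,
        {in s, forall f,
           (exists nu : dual m, f = supercharacter theta nu) /\ f 1 = d},
        (0 < k)%N
      & {in algebra_group m, forall g,
           supercharacter theta lam g = \sum_(f <- s) k%:R * f g}].
Proof.
have [R trR] := two_sided_orbit_transversal mu.
have [k k_gt0 kE] := restr_multiplicity lam.
have sRD nu : nu \in R -> nu \in two_sided_orbit n mu.
  exact: (subsetP (transversal_sub trR)).
have orb_refl :
    {in two_sided_orbit n mu, forall nu, nu \in two_sided_orbit m nu}.
  by move=> nu _; apply: (mem_two_sided_orbit nil_n nil_m st_m sub_mn).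
exists [seq supercharacter theta nu | nu <- enum R].
exists #|left_orbit m mu|%:R, k; split=> //.
- rewrite map_inj_in_uniq ?enum_uniq // => nu nu'.
  rewrite !mem_enum => Rnu Rnu'.
  move/(supercharacter_inj theta_char nil_m).
  move/(two_sided_orbit_eq nil_n nil_m st_m sub_mn).
  exact: (transversal_orbit_inj orb_refl trR).
- rewrite size_map -cardE.
  have : #|two_sided_orbit n mu|%:R =
         \sum_(nu in R) #|two_sided_orbit m mu|%:R :> C.
    rewrite -sum1_card natr_sum (big_transversal_orbit orb_refl trR).
    apply: eq_bigr => nu /sRD Rnu; rewrite -natr_sum sum1_card.
    by rewrite (two_sided_orbit_cards nil_n nil_m sub_mn st_m Rnu).2.
  rewrite sumr_const => tsnE; apply: (canRL (mulfK (tsm_neq0 mu))).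
  by rewrite tsnE mulr_natl.
- move=> _ /mapP[nu + ->]; rewrite mem_enum => /sRD Rnu.
  split; first by exists nu.
  rewrite (supercharacter1 theta_char nil_m).
  by rewrite (two_sided_orbit_cards nil_n nil_m sub_mn st_m Rnu).1.
move=> g mg; rewrite (restr_supercharacter_transversal trR mg) kE.
by rewrite big_map big_enum /= mulr_sumr.
Qed.

Lemma restr_two_sided_orbit (lam : dual n) :
  [set dual_restr m lam' | lam' in two_sided_orbit n lam] =
  two_sided_orbit n (dual_restr m lam).
Proof.
rewrite (two_sided_orbitE nil_n nil_n st_n (subvv n)).
rewrite (two_sided_orbitE nil_n nil_n st_m (subvv n)) -imset_comp.
by apply: eq_in_imset => a Da /=; apply: dual_restr_act.
Qed.

Lemma restr_orbit_mem (lam : dual n) (mu : dual m) :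
  ([set dual_restr m lam' | lam' in two_sided_orbit n lam]
     == two_sided_orbit n mu) = (dual_restr m lam \in two_sided_orbit n mu).
Proof.
rewrite restr_two_sided_orbit; apply/eqP/idP => [<- | ].
  exact: (mem_two_sided_orbit nil_n nil_n st_m (subvv n)).
exact: (two_sided_orbit_eq nil_n nil_n st_m (subvv n)).
Qed.

(** When X is outside m, translation by a functional that vanishes on m
    permutes the preimage and multiplies every term by theta (ka X), which can be
    chosen different from 1. *)
Lemma sum_preimage_orbit (mu : dual m) (X : A) : X \in n ->
  \sum_(lam : dual n | dual_restr m lam \in two_sided_orbit n mu)
     theta (deval lam X) =
  if X \in m then #|vset n|%:R / #|vset m|%:R *
     \sum_(nu in two_sided_orbit n mu) theta (deval nu X) else 0.
Proof.
move=> nX; case: ifPn => [mX | nmX].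
  have := sum_restr_preimage sub_mn (two_sided_orbit n mu)
    (fun nu => theta (deval nu X)).
  have n_neq0 : #|vset n|%:R != 0 :> C.
    by rewrite pnatr_eq0 -lt0n -(card_unipotent_group nil_n) cardG_gt0.
  move/(canRL (divfK n_neq0)) => sumE.
  rewrite [RHS]mulrC [_ / _ in RHS]mulrC mulrA -sumE.
  by apply: eq_bigr => lam _; rewrite deval_restr.
have [_ _ [b theta_b]] := theta_char.
have [ka ka0 kaX] := dual_extra_value sub_mn b nX nmX.
pose S := [set lam : dual n | dual_restr m lam \in two_sided_orbit n mu].
rewrite (eq_bigl [in S]); last by move=> lam; rewrite inE.
apply: (sum_eigen_shift (@dual_add_inj _ _ n ka) _ theta_b) => lam; last first.
  by move=> _; rewrite deval_add kaX (theta_add theta_char) mulrC.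
rewrite !inE dual_restr_add.
have -> // : dual_add (dual_restr m lam) (dual_restr m ka) = dual_restr m lam.
apply: dual_ext => Y mY; rewrite deval_add.
by rewrite [deval (dual_restr m ka) Y]deval_restr // ka0 ?addr0.
Qed.

(** Inverting y turns the double sum into a sum over the action of U x U. *)
Lemma sum_two_sided_translates (nu : dual m) (X : A) : X \in m ->
  \sum_(x in algebra_group n) \sum_(y in algebra_group n)
     theta (deval nu ((x : A) * X * (y : A))) =
  (#|vset n|%:R * #|vset n|%:R) / #|two_sided_orbit n nu|%:R *
  \sum_(ka in two_sided_orbit n nu) theta (deval ka X).
Proof.
move=> mX; have n_neq0 : #|vset n|%:R != 0 :> C.
  by rewrite pnatr_eq0 -lt0n -(card_unipotent_group nil_n) cardG_gt0.
have := two_sided_orbit_mean nil_n nil_n st_m (subvv n)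
  (fun ka => theta (deval ka X)) nu.
rewrite cardsX !(card_unipotent_group nil_n) natrM => mean.
rewrite [RHS]mulrAC -mulrA mean mulrC divfK ?mulf_neq0 //.
rewrite big_algebra_group.
under eq_bigr => u Uu.
  rewrite big_algebra_group (reindex_inj (@invg_inj {unit fA})).
  rewrite (eq_bigl [in U]) => [|v]; last by rewrite groupV.
  over.
rewrite pair_big_dep /=; apply: eq_big => [[u v]|[u v] /andP[Uu Uv]].
  by rewrite mem_setX.
by rewrite [in RHS]deval_dual_act.
Qed.

Lemma sind_supercharacterE (mu : dual m) g : g \in algebra_group n ->
  sind n m (supercharacter theta mu) g =
  if (g - 1 : A) \in m then
    #|left_orbit m mu|%:R / #|two_sided_orbit n mu|%:R *
    (#|vset n|%:R / #|vset m|%:R *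
     \sum_(nu in two_sided_orbit n mu) theta (deval nu (g - 1)))
  else 0.
Proof.
move=> ng; rewrite ffunE ng.
have memE (x y : fA) : x \in algebra_group n -> y \in algebra_group n ->
    (x * (g - 1) * y + 1 \in algebra_group m) = ((g - 1 : A) \in m).
  move=> nx ny; rewrite inE addrK; apply/idP/idP => [mz | mg]; last exact: st_m.
  have [ux nx'] := algebra_group_inv nil_n nx.
  have [uy ny'] := algebra_group_inv nil_n ny.
  have -> : (g - 1 : A) = x^-1 * (x * (g - 1) * y) * y^-1.
    by rewrite !mulrA mulVr // mul1r mulrK.
  exact: st_m.
case: ifPn => mg; last first.
  rewrite big1 ?mulr0 // => x nx; rewrite big1 // => y ny.
  by rewrite /= memE // (negPf mg).
rewrite (eq_bigr (fun x : fA => \sum_(y in algebra_group n)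
   #|left_orbit m mu|%:R / #|two_sided_orbit m mu|%:R *
   \sum_(nu in two_sided_orbit m mu)
     theta (deval nu ((x : A) * (g - 1) * y)))); last first.
  move=> x nx; apply: eq_bigr => y ny; rewrite /= memE // mg.
  by rewrite ffunE memE // mg addrK.
rewrite (eq_bigr (fun x : fA =>
   #|left_orbit m mu|%:R / #|two_sided_orbit m mu|%:R *
   \sum_(nu in two_sided_orbit m mu) \sum_(y in algebra_group n)
   theta (deval nu ((x : A) * (g - 1) * y)))); last first.
  by move=> x _; rewrite -mulr_sumr exchange_big.
rewrite -mulr_sumr exchange_big /=.
have tsE nu : nu \in two_sided_orbit m mu ->
    two_sided_orbit n nu = two_sided_orbit n mu.
  move=> nu_mu; apply: (two_sided_orbit_eq nil_n nil_n st_m (subvv n)).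
  apply: (subsetP (two_sided_orbit_sub nil_n nil_m sub_mn st_m _)) nu_mu.
  exact: (mem_two_sided_orbit nil_n nil_n st_m (subvv n)).
rewrite (eq_bigr (fun=>
  (#|vset n|%:R * #|vset n|%:R) / #|two_sided_orbit n mu|%:R *
  \sum_(ka in two_sided_orbit n mu) theta (deval ka (g - 1)))); last first.
  by move=> nu nu_mu; rewrite sum_two_sided_translates // tsE.
rewrite sumr_const !card_algebra_group -[_ *+ #|two_sided_orbit m mu|]mulr_natr.
have vs_neq0 (V : {vspace A}) : #|vset V|%:R != 0 :> C.
  by rewrite pnatr_eq0 -lt0n; apply/card_gt0P; exists 0; rewrite inE mem0v.
set S := \sum_(_ in _) _; field.
by rewrite !vs_neq0 tsn_neq0 tsm_neq0.
Qed.

End Main.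

Theorem theorem5p1 (F : finFieldType) (A : falgType F) (C : numClosedFieldType)
    (theta : F -> C) (n m : {vspace A}) :
  nontrivial_additive_character theta ->
  nilpotent_algebra n -> nilpotent_algebra m -> (m <= n)%VS ->
  supernormal n (algebra_group m) ->
  (forall lambda : dual n,
     let mu : dual m := dual_restr m lambda in
     let c : C :=
       (#|left_orbit n lambda|%:R * #|two_sided_orbit m mu|%:R) /
       (#|left_orbit m mu|%:R * #|two_sided_orbit n mu|%:R) in
     (forall R : {set dual m},
        is_transversal R
          [set two_sided_orbit m nu | nu in two_sided_orbit n mu]
          (two_sided_orbit n mu) ->
        {in algebra_group m, forall g,
           supercharacter theta lambda g =
           c * \sum_(nu in R) supercharacter theta nu g}) /\
     (exists (s : seq {ffun finvect_type A -> C}) (d : C) (k : nat),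
        [/\ uniq s,
            (size s)%:R = #|two_sided_orbit n mu|%:R /
                          #|two_sided_orbit m mu|%:R :> C,
            {in s, forall f,
               (exists nu : dual m, f = supercharacter theta nu) /\ f 1 = d},
            (0 < k)%N
          & {in algebra_group m, forall g,
               supercharacter theta lambda g = \sum_(f <- s) k%:R * f g}])) /\
  (forall mu : dual m,
     let D : {set dual n} :=
       [set lambda | [set dual_restr m lambda' |
                        lambda' in two_sided_orbit n lambda]
                     == two_sided_orbit n mu] in
     forall R : {set dual n},
       is_transversal R [set two_sided_orbit n lambda | lambda in D] D ->
       {in algebra_group n, forall g,
          sind n m (supercharacter theta mu) g =
          \sum_(lambda in R)
             (#|left_orbit m mu|%:R * #|two_sided_orbit n lambda|%:R) /
             (#|left_orbit n lambda|%:R * #|two_sided_orbit n mu|%:R) *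
             supercharacter theta lambda g}).
Proof.
move=> theta_char nil_n nil_m sub_mn super_m.
have st_m := supernormal_bistable nil_n super_m; have st_n := bistable_self nil_n.
split=> [lam mu c | mu D R trR g ng].
  split=> [R trR g mg|].
    exact: restr_supercharacter_transversal.
  exact: restr_supercharacter_decomposition.
have DE lam : (lam \in D) = (dual_restr m lam \in two_sided_orbit n mu).
  by rewrite inE restr_orbit_mem.
have nX : (g - 1 : A) \in n by rewrite inE in ng.
rewrite sind_supercharacterE //.
pose c : C := #|left_orbit m mu|%:R / #|two_sided_orbit n mu|%:R.
transitivity (c * \sum_(lam in D) theta (deval lam (g - 1))).
  rewrite (eq_bigl _ _ DE) sum_preimage_orbit //.
  by case: ifP => // _; rewrite mulr0.
rewrite (big_transversal_orbit _ trR) => [|lam _]; last first.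
  exact: (mem_two_sided_orbit nil_n nil_n st_n (subvv n)).
rewrite big_distrr; apply: eq_bigr => lam _ /=.
have ln_neq0 : #|left_orbit n lam|%:R != 0 :> C.
  by rewrite pnatr_eq0 -lt0n (left_orbit_gt0 nil_n nil_n st_n (subvv n)).
have tn_neq0 : #|two_sided_orbit n lam|%:R != 0 :> C.
  by rewrite pnatr_eq0 -lt0n (two_sided_orbit_gt0 nil_n nil_n st_n (subvv n)).
have tm_neq0 : #|two_sided_orbit n mu|%:R != 0 :> C.
  by rewrite pnatr_eq0 -lt0n (two_sided_orbit_gt0 nil_n nil_n st_m (subvv n)).
rewrite ffunE ng mulrA; congr (_ * _); rewrite /c; field.
by rewrite ln_neq0 tn_neq0 tm_neq0.
Qed.
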